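(* Let $\mathcal{A}$ be an abelian category with enough projectives, and let $\mathcal{X}$ be a precovering self-orthogonal subcategory of $\mathcal{A}$ which is closed under extensions and direct summands. Then, for a positive integer $n$, $\mathrm{l.}\mathcal{X}\text{-}\mathrm{gl.dim}(\mathcal{A})=n$ if and only if $\mathrm{l.gl.dim}(\mathcal{A})=n$ and $\mathcal{X}$ coincides with $P(\mathcal{A})$, the subcategory of all projective objects of $\mathcal{A}$.
   Context: ''Subcategory'' means full subcategory closed under isomorphisms and containing the zero object. $\mathcal{X}$ is self-orthogonal if $\mathrm{Ext}^i(X,X')=0$ for all $i\geq 1$ and all $X,X'\in\mathcal{X}$. $\mathcal{X}$ is precovering if every object $M$ of $\mathcal{A}$ admits an $\mathcal{X}$-precover, i.e. a morphism $\varphi:X\to M$ with $X\in\mathcal{X}$ such that $\mathrm{Hom}(X',\varphi)$ is surjective for every $X'\in\mathcal{X}$. $\mathrm{e.l}_{\mathcal{X}}\text{-}\dim(M)$ is the least integer $m\geq 0$ for which there is an exact sequence $0\to A_m\to\cdots\to A_0\to M\to 0$ with all $A_i\in\mathcal{X}$, and $\infty$ if there is none. $\mathrm{l.gl.dim}(\mathcal{A})$ is the supremum of the projective dimensions of all objects of $\mathcal{A}$, and $\mathrm{l.}\mathcal{X}\text{-}\mathrm{gl.dim}(\mathcal{A})$ is the supremum of $\mathrm{e.l}_{\mathcal{X}}\text{-}\dim(M)$ over all objects $M$ of $\mathcal{A}$. *)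

(* Defs.v *)
From HB Require Import structures.
From mathcomp Require Import all_boot all_algebra.
From mathcomp Require Import boolp classical_sets.

Set Implicit Arguments.
Unset Strict Implicit.
Unset Printing Implicit Defensive.

Import GRing.Theory.
Local Open Scope ring_scope.
Local Open Scope quotient_scope.

(** * Extended natural numbers: [None] stands for infinity *)

Definition enat := option nat.

Definition le_enat (x y : enat) : Prop :=
  match x, y with
  | _, None => True
  | None, Some _ => False
  | Some m, Some n => (m <= n)%N
  end.

Lemma asbool_ex (P : nat -> Prop) :
  (exists m, P m) -> exists m, (fun k => `[< P k >]) m.
Proof. by case=> m Pm; exists m; apply/asboolP. Qed.

(* The infimum in [enat] of a set of natural numbers (infinity if empty). *)
Definition einf (P : set nat) : enat :=
  if pselect (exists m, P m) is left exP then Some (ex_minn (asbool_ex exP))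
  else None.

(* The supremum in [enat] of a family: the least natural number bounding it,
   infinity if there is none. *)
Definition esup (I : Type) (F : I -> enat) : enat :=
  einf [set b | forall i, le_enat (F i) (Some b)].

(** * Subquotients of abelian groups *)

Section Subquotient.
Variables (V : zmodType) (Z B : zmodClosed V).

Record subgroup := Subgroup { subgroup_val :> V; _ : subgroup_val \in Z }.

HB.instance Definition _ := [isSub for subgroup_val].
HB.instance Definition _ := [Choice of subgroup by <:].
HB.instance Definition _ := [SubChoice_isSubZmodule of subgroup by <:].

Definition trace : {pred subgroup} := fun z => val z \in B.

Lemma trace_zmod_closed : zmod_closed trace.
Proof.
split=> [|x y].
  by change (val (0 : subgroup) \in B); rewrite raddf0 rpred0.
move=> xB yB; change (val (x - y) \in B).
by rewrite raddfB rpredB.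
Qed.

HB.instance Definition _ :=
  GRing.isZmodClosed.Build subgroup trace trace_zmod_closed.

(* Z / (Z :&: B); in the use below B is contained in Z. *)
Definition subquotient : zmodType := Quotient.quot trace.

Lemma subquotient_trivialP :
  (forall e : subquotient, e = 0) <-> {subset Z <= B}.
Proof.
split=> [triv x Zx | ZB e].
  have : Subgroup Zx = 0 %[mod Quotient.quot trace].
    by rewrite [LHS]triv [RHS]triv.
  by move/eqP; rewrite -Quotient.idealrBE subr0.
rewrite -[e]reprK; case: (repr e) => x Zx.
transitivity (\pi_(Quotient.quot trace) 0); last by rewrite raddf0.
by apply/eqP; rewrite -Quotient.idealrBE subr0; apply: ZB.
Qed.

End Subquotient.

(** * Abelian categories *)

(* [comp g f] is "g after f"; composition is bilinear. *)
Record preadditive_category := PreadditiveCategory {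
  obj :> Type;
  hom : obj -> obj -> zmodType;
  idm : forall M, hom M M;
  comp : forall L M N, hom M N -> hom L M -> hom L N;
  compA : forall K L M N (h : hom M N) (g : hom L M) (f : hom K L),
    comp h (comp g f) = comp (comp h g) f;
  comp1m : forall M N (f : hom M N), comp (idm N) f = f;
  compm1 : forall M N (f : hom M N), comp f (idm M) = f;
  compDl : forall L M N (g g' : hom M N) (f : hom L M),
    comp (g + g') f = comp g f + comp g' f;
  compDr : forall L M N (g : hom M N) (f f' : hom L M),
    comp g (f + f') = comp g f + comp g f';
}.

Arguments hom {p}.
Arguments idm {p}.
Arguments comp {p L M N}.

Notation "g \oc f" := (comp g f) (at level 40, left associativity).

Section Preadditive.
Variable A : preadditive_category.
Implicit Types K L M N : A.

Definition is_zero_object M : Prop :=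
  forall N, (forall f : hom M N, f = 0) /\ (forall f : hom N M, f = 0).

Definition mono M N (f : hom M N) : Prop :=
  forall L (g h : hom L M), f \oc g = f \oc h -> g = h.

Definition epi M N (f : hom M N) : Prop :=
  forall L (g h : hom N L), g \oc f = h \oc f -> g = h.

Definition isomorphic M N : Prop :=
  exists (f : hom M N) (g : hom N M), g \oc f = idm M /\ f \oc g = idm N.

Definition is_kernel M N (f : hom M N) K (k : hom K M) : Prop :=
  f \oc k = 0 /\
  forall L (g : hom L M), f \oc g = 0 -> exists! h : hom L K, k \oc h = g.

Definition is_cokernel M N (f : hom M N) K (c : hom N K) : Prop :=
  c \oc f = 0 /\
  forall L (g : hom N L), g \oc f = 0 -> exists! h : hom K L, h \oc c = g.

Definition is_biproduct S M N (i : hom M S) (j : hom N S)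
    (p : hom S M) (q : hom S N) : Prop :=
  [/\ p \oc i = idm M, q \oc j = idm N, p \oc j = 0, q \oc i = 0
    & i \oc p + j \oc q = idm S].

Record is_abelian : Prop := IsAbelian {
  has_zero_object : exists Z, is_zero_object Z;
  has_biproducts : forall M N, exists S (i : hom M S) (j : hom N S)
    (p : hom S M) (q : hom S N), is_biproduct i j p q;
  has_kernels : forall M N (f : hom M N),
    exists K (k : hom K M), is_kernel f k;
  has_cokernels : forall M N (f : hom M N),
    exists K (c : hom N K), is_cokernel f c;
  mono_normal : forall M N (f : hom M N), mono f ->
    exists L (g : hom N L), is_kernel g f;
  epi_normal : forall M N (f : hom M N), epi f ->
    exists L (g : hom L M), is_cokernel g f;
}.

(* Exactness at M of L --f--> M --g--> N: the image of f, that is, the kernel k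
   of the cokernel c of f, is a kernel of g. *)
Definition exact L M N (f : hom L M) (g : hom M N) : Prop :=
  exists C (c : hom M C) I (k : hom I M),
    [/\ is_cokernel f c, is_kernel c k & is_kernel g k].

Definition short_exact L M N (f : hom L M) (g : hom M N) : Prop :=
  [/\ mono f, exact f g & epi g].

Definition projective (P : A) : Prop :=
  forall M N (e : hom M N) (f : hom P N), epi e ->
    exists g : hom P M, e \oc g = f.

Definition projectives : set A := [set P | projective P].

Definition enough_projectives : Prop :=
  forall M, exists P (e : hom P M), projective P /\ epi e.

(** Exact sequences ... --> R_1 --> R_0 --> M --> 0 *)

Record resolution M := Resolution {
  rterm :> nat -> A;
  rdiff : forall i, hom (rterm i.+1) (rterm i);
  raug : hom (rterm 0) M;
  raug_epi : epi raug;
  rexact0 : exact (rdiff 0) raug;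
  rexactS : forall i, exact (rdiff i.+1) (rdiff i);
}.

(** Full subcategories, given by their classes of objects *)

Section Subcategory.
Variable X : set A.

Definition is_subcategory : Prop :=
  (forall M N, isomorphic M N -> X M -> X N) /\
  (exists Z, is_zero_object Z /\ X Z).

Definition closed_under_extensions : Prop :=
  forall L M N (f : hom L M) (g : hom M N),
    short_exact f g -> X L -> X N -> X M.

Definition closed_under_summands : Prop :=
  forall S M N (i : hom M S) (j : hom N S) (p : hom S M) (q : hom S N),
    is_biproduct i j p q -> X S -> X M.

Definition is_precover M C (phi : hom C M) : Prop :=
  X C /\ forall C', X C' ->
    forall f : hom C' M, exists g : hom C' C, phi \oc g = f.

Definition precovering : Prop :=
  forall M, exists C (phi : hom C M), is_precover phi.

(* An exact sequence 0 -> A_m -> ... -> A_0 -> M -> 0 is a resolution of M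
   with zero objects in all degrees above m. *)
Definition has_resolution_of_length M (m : nat) : Prop :=
  exists R : resolution M,
    (forall i, (i <= m)%N -> X (R i)) /\
    (forall i, (m < i)%N -> is_zero_object (R i)).

Definition el_dim M : enat := einf (has_resolution_of_length M).

Definition relative_gl_dim : enat := esup el_dim.

End Subcategory.

Definition proj_dim M : enat := el_dim projectives M.

Definition gl_dim : enat := esup proj_dim.

(** Cohomology of the complex Hom(R_0, Y) -> Hom(R_1, Y) -> ... *)

Lemma comp0m L M N (f : hom L M) : (0 : hom M N) \oc f = 0.
Proof. by apply: (addrI ((0 : hom M N) \oc f)); rewrite -compDl !addr0. Qed.

Lemma compm0 L M N (f : hom M N) : f \oc (0 : hom L M) = 0.
Proof. by apply: (addrI (f \oc (0 : hom L M))); rewrite -compDr !addr0. Qed.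

Lemma compBl L M N (g g' : hom M N) (f : hom L M) :
  (g - g') \oc f = g \oc f - g' \oc f.
Proof. by apply: (addIr (g' \oc f)); rewrite -compDl !subrK. Qed.

Lemma compBr L M N (g : hom M N) (f f' : hom L M) :
  g \oc (f - f') = g \oc f - g \oc f'.
Proof. by apply: (addIr (g \oc f')); rewrite -compDr !subrK. Qed.

Section Cohomology.
Variables (M : A) (R : resolution M) (Y : A).

Definition cocycle i : {pred hom (R i) Y} :=
  fun f => `[< f \oc rdiff R i = 0 >].

Definition coboundary i : {pred hom (R i) Y} :=
  match i with
  | 0 => fun f => f == 0
  | j.+1 => fun f => `[< exists g : hom (R j) Y, f = g \oc rdiff R j >]
  end.

Lemma cocycle_zmod_closed i : zmod_closed (@cocycle i).
Proof.
split=> [|f g]; first by apply/asboolP; rewrite comp0m.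
by move=> /asboolP f0 /asboolP g0; apply/asboolP; rewrite compBl f0 g0 subr0.
Qed.

Lemma coboundary_zmod_closed i : zmod_closed (@coboundary i).
Proof.
case: i => [|j]; split.
- exact: eqxx.
- by move=> f g /eqP-> /eqP->; rewrite subr0; apply: eqxx.
- by apply/asboolP; exists 0; rewrite comp0m.
- move=> f g /asboolP[f' ->] /asboolP[g' ->].
  by apply/asboolP; exists (f' - g'); rewrite compBl.
Qed.

HB.instance Definition _ i :=
  GRing.isZmodClosed.Build (hom (R i) Y) (@cocycle i) (cocycle_zmod_closed i).
HB.instance Definition _ i :=
  GRing.isZmodClosed.Build (hom (R i) Y) (@coboundary i)
    (coboundary_zmod_closed i).

Definition cohomology i : zmodType := subquotient (@cocycle i) (@coboundary i).

End Cohomology.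

(** Existence of projective resolutions *)

Lemma kernel_mono M N (f : hom M N) K (k : hom K M) : is_kernel f k -> mono k.
Proof.
move=> [fk0 kU] L g h kgh.
have [|u [_ uU]] := kU L (k \oc g); first by rewrite compA fk0 comp0m.
by rewrite -(uU g) // -(uU h).
Qed.

Lemma mono_comp0 L M N (f : hom M N) (g : hom L M) :
  mono f -> f \oc g = 0 -> g = 0.
Proof. by move=> fm fg0; apply: fm; rewrite fg0 compm0. Qed.

Lemma epi_comp0 L M N (f : hom M N) (g : hom L M) :
  epi g -> f \oc g = 0 -> f = 0.
Proof. by move=> ge fg0; apply: ge; rewrite fg0 comp0m. Qed.

Lemma mono_kernel_coker M N (f : hom M N) C (c : hom N C) :
  is_abelian -> mono f -> is_cokernel f c -> is_kernel c f.
Proof.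
move=> abA fm [cf0 cU]; split=> // L g cg0.
have [D [e [ef0 eU]]] := mono_normal abA fm.
have [u [uc _]] := cU D e ef0.
by apply: eU; rewrite -uc -compA cg0 compm0.
Qed.

Lemma exact_kernel_epi L K M N (e : hom L K) (k : hom K M) (g : hom M N) :
  is_abelian -> epi e -> is_kernel g k -> exact (k \oc e) g.
Proof.
move=> abA ee kg; have km := kernel_mono kg.
have [C [c ck]] := has_cokernels abA k; have kc := mono_kernel_coker abA km ck.
exists C, c, K, k; split=> //; case: ck => ck0 cU.
split=> [|D h hke0]; first by rewrite compA ck0 comp0m.
by apply: cU; apply: (epi_comp0 ee); rewrite -compA.
Qed.

Lemma kernel_comp_mono K L M N (k : hom K L) (g : hom L M) (m : hom M N) :
  mono m -> is_kernel g k -> is_kernel (m \oc g) k.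
Proof.
move=> mm [gk0 kU]; split=> [|D h mgh0]; first by rewrite -compA gk0 compm0.
by apply: kU; apply: (mono_comp0 mm); rewrite compA.
Qed.

Section ProjectiveResolution.
Hypotheses (abA : is_abelian) (epA : enough_projectives).

Lemma cover_data M : {P : A & {e : hom P M | projective P /\ epi e}}.
Proof. by have [P /cid] := cid (epA M); exists P. Qed.

Lemma kernel_data M N (f : hom M N) :
  {K : A & {k : hom K M | is_kernel f k}}.
Proof. by have [K /cid] := cid (has_kernels abA f); exists K. Qed.

Let cover M : A := projT1 (cover_data M).
Let cover_map M : hom (cover M) M := sval (projT2 (cover_data M)).
Let ker M : A := projT1 (kernel_data (cover_map M)).
Let ker_map M : hom (ker M) (cover M) :=
  sval (projT2 (kernel_data (cover_map M))).

Lemma projective_resolution_exists M :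
  exists R : resolution M, forall i, projective (R i).
Proof.
pose syz i := iter i ker M.
pose d i : hom (cover (syz i.+1)) (cover (syz i)) :=
  ker_map (syz i) \oc cover_map (syz i.+1).
have covP N : projective (cover N) /\ epi (cover_map N).
  exact: svalP (projT2 (cover_data N)).
have kerP N : is_kernel (cover_map N) (ker_map N).
  exact: svalP (projT2 (kernel_data (cover_map N))).
have d0 : exact (d 0) (cover_map M).
  by apply: exact_kernel_epi => //; case: (covP (syz 1)).
have dS i : exact (d i.+1) (d i).
  apply: exact_kernel_epi => //; first by case: (covP (syz i.+2)).
  by apply: kernel_comp_mono (kerP _); apply: kernel_mono (kerP _).
exists (Resolution (proj2 (covP M)) d0 dS) => i /=.
by case: (covP (syz i)).
Qed.

Definition proj_resolution M : resolution M :=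
  sval (cid (projective_resolution_exists M)).

Lemma proj_resolutionP M i : projective (proj_resolution M i).
Proof. exact: svalP (cid (projective_resolution_exists M)) i. Qed.

(* The right derived functors of Hom(-, N), computed from a chosen projective
   resolution of M. *)
Definition Ext (i : nat) M N : zmodType := cohomology (proj_resolution M) N i.

Lemma Ext_trivialP i M N :
  (forall e : Ext i.+1 M N, e = 0) <->
  (forall f : hom (proj_resolution M i.+1) N,
     f \oc rdiff (proj_resolution M) i.+1 = 0 ->
     exists g : hom (proj_resolution M i) N,
       f = g \oc rdiff (proj_resolution M) i).
Proof.
split=> [/subquotient_trivialP ZB f /asboolP f0 | ZB].
  by apply/asboolP; apply: (ZB f f0).
apply/subquotient_trivialP => f /asboolP f0.
by apply/asboolP; apply: ZB.
Qed.

Definition self_orthogonal (X : set A) : Prop :=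
  forall M N, X M -> X N -> forall i, (1 <= i)%N ->
    forall e : Ext i M N, e = 0.

End ProjectiveResolution.

End Preadditive.

Arguments projectives : clear implicits.
Arguments gl_dim : clear implicits.

(* Main.v *)
(** Let every object have a finite resolution by objects of [X]. Chasing a
    cocycle along such a resolution of [N] (dimension shifting) gives
    [Ext^i (C, N) = 0] for all [i >= 1], [C] in [X] and all [N], so that the
    objects of [X] are projective. Conversely a projective [P] is a direct
    summand of the degree [0] term of a resolution of [P], hence lies in [X].
    Once [X] is the class of projectives both dimensions are the same. *)

Require Import Defs.
From mathcomp Require Import all_boot all_algebra.
From mathcomp Require Import boolp classical_sets.
(* MathComp shadows [hom]. *)
Import Defs.

Set Implicit Arguments.
Unset Strict Implicit.
Unset Printing Implicit Defensive.

Import GRing.Theory.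
Local Open Scope ring_scope.

Lemma einf_Some (P : set nat) m : einf P = Some m -> P m.
Proof.
rewrite /einf; case: pselect => // exP [<-].
by case: ex_minnP => k /asboolP.
Qed.

Lemma esup_Some (I : Type) (F : I -> enat) n i :
  esup F = Some n -> exists m, F i = Some m.
Proof. by move/einf_Some/(_ i); case: (F i) => // m _; exists m. Qed.

Section Abelian.
Variables (A : preadditive_category) (abA : is_abelian A).
Implicit Types C L M N P Y : A.

Lemma exact_comp0 L M N (f : hom L M) (g : hom M N) :
  exact f g -> g \oc f = 0.
Proof.
move=> [C [c [I [k [[cf0 _] [_ kU] [gk0 _]]]]]].
have [h [<- _]] := kU _ _ cf0.
by rewrite compA gk0 comp0m.
Qed.

(** A morphism is epi onto its image [k]: if [u] and [v] agree on [f'], then [f'] factors through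
    the kernel [t] of [u - v], and minimality of the image splits [t]. *)
Lemma coker_kernel_epi L M C I (f : hom L M) (c : hom M C) (k : hom I M)
    (f' : hom L I) :
  is_cokernel f c -> is_kernel c k -> k \oc f' = f -> epi f'.
Proof.
move=> [_ cU] kc kf' D u v uv.
have [T [t kt]] := has_kernels abA (u - v).
have [s [ts _]] : exists! s, t \oc s = f'.
  by apply: kt.2; rewrite compBl uv subrr.
have km := kernel_mono kc; have tm := kernel_mono kt.
(* [k \oc t] is a mono through which [f] factors, so it contains the image of
   [f]: it is the kernel of some [e], and [e] factors through [c]. *)
have ktm : mono (k \oc t).
  by move=> B g h; rewrite -!compA => /km/tm.
have [B [e [ekt0 eU]]] := mono_normal abA ktm.
have [e' [e'c _]] : exists! e', e' \oc c = e.
  by apply: cU; rewrite -kf' -ts (compA k) compA ekt0 comp0m.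
have [r [ktr _]] : exists! r, (k \oc t) \oc r = k.
  by apply: eU; rewrite -e'c -compA kc.1 compm0.
have tr1 : t \oc r = idm I by apply: km; rewrite compA ktr compm1.
apply/eqP; rewrite -subr_eq0; apply/eqP.
by rewrite -[u - v]compm1 -tr1 compA kt.1 comp0m.
Qed.

Lemma projective_exact_lift P L M N (f : hom L M) (g : hom M N)
    (h : hom P M) :
  projective P -> exact f g -> g \oc h = 0 -> exists l, f \oc l = h.
Proof.
move=> projP [C [c [I [k [cf kc kg]]]]] gh0.
have [f' [kf' _]] := kc.2 _ _ cf.1.
have [h' [<- _]] := kg.2 _ _ gh0.
have [l <-] := projP _ _ _ h' (coker_kernel_epi cf kc kf').
by exists l; rewrite compA kf'.
Qed.

(** The epi [g] is the cokernel of some [t], and [t] factors through the image of [f], which [y]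
    kills. *)
Lemma exact_epi_factor L M N Y (f : hom L M) (g : hom M N) (y : hom M Y) :
  exact f g -> epi g -> y \oc f = 0 -> exists w, w \oc g = y.
Proof.
move=> [C [c [I [k [[_ cU] [ck0 _] [_ kU]]]]]] gE yf0.
have [K [t [gt0 tU]]] := epi_normal abA gE.
have [y' [y'c _]] := cU _ _ yf0; have [t' [kt' _]] := kU _ _ gt0.
have [|w [wg _]] := tU _ y; last by exists w.
by rewrite -y'c -kt' -compA (compA c) ck0 comp0m compm0.
Qed.

Lemma split_epi_biproduct M N (e : hom M N) (s : hom N M) :
  e \oc s = idm N ->
  exists K (k : hom K M) (q : hom M K), is_biproduct s k e q.
Proof.
move=> es1; have [K [k kk]] := has_kernels abA e.
(* The idempotent complementary to [s \oc e] lands in the kernel of [e]; this gives the second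
   projection. *)
have [|q [kq _]] := kk.2 _ (idm M - s \oc e).
  by rewrite compBr compm1 compA es1 comp1m subrr.
have km := kernel_mono kk; exists K, k, q; split=> //; last 2 first.
- apply: (mono_comp0 km).
  by rewrite compA kq compBl comp1m -compA es1 compm1 subrr.
- by rewrite kq addrC subrK.
- by apply: km; rewrite compA kq compBl comp1m -compA kk.1 compm0 subr0 compm1.
- exact: kk.1.
Qed.

(** Packing the map with its codomain lets an induction on the degree treat the augmentation and the
    differentials alike. *)
Definition resolution_boundary M (R : resolution M) j : {N : A & hom (R j) N} :=
  if j is i.+1 then existT _ (R i) (rdiff R i) else existT _ M (raug R).

Notation rbound R j := (projT2 (resolution_boundary R j)).

Lemma resolution_exact M (R : resolution M) j :
  exact (rdiff R j) (rbound R j).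
Proof. by case: j => [|j]; [apply: rexact0 | apply: rexactS]. Qed.

Hypothesis epA : enough_projectives A.

(* [f \oc d] lifts to a cocycle with values in degree [j.+1] of the resolution
   of [N], so the induction runs downwards from the zero terms of [R]. *)
Lemma resolution_cocycle_factor C N (R : resolution N) m j i
    (f : hom (proj_resolution abA epA C i.+1) (R j)) :
  (forall k, (k < j + m)%N -> forall l (e : Ext abA epA l.+1 C (R k)), e = 0) ->
  (forall k, (j + m <= k)%N -> is_zero_object (R k)) ->
  rbound R j \oc f \oc rdiff (proj_resolution abA epA C) i.+1 = 0 ->
  exists g, rbound R j \oc f =
    rbound R j \oc g \oc rdiff (proj_resolution abA epA C) i.
Proof.
set P := proj_resolution abA epA C.
elim: m j i f => [|m IHm] j i f orthR zeroR bfd0.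
  have [|_ /(_ f) ->] := zeroR j _ (P i.+1); first by rewrite addn0.
  by exists 0; rewrite !compm0 comp0m.
have PP k : projective (P k) by apply: proj_resolutionP.
have [h dh] : exists h, rdiff R j \oc h = f \oc rdiff P i.+1.
  by apply: projective_exact_lift (PP _) (resolution_exact R j) _; rewrite compA.
have [||| g dg] := IHm j.+1 i.+1 h.
- by move=> k; rewrite addSnnS; apply: orthR.
- by move=> k; rewrite addSnnS; apply: zeroR.
- by rewrite /= dh -compA (exact_comp0 (rexactS P i.+1)) compm0.
have jm : (j < j + m.+1)%N by rewrite addnS ltnS leq_addr.
(* Subtracting [rdiff R j \oc g] turns [f] into a true cocycle, and [rbound R j] does not see the
   correction. *)
have /Ext_trivialP/(_ (f - rdiff R j \oc g))[|u fgu] := orthR j jm i.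
  by rewrite compBl -dh -dg subrr.
exists u; rewrite -compA -fgu compBr compA.
by rewrite (exact_comp0 (resolution_exact R j)) comp0m subr0.
Qed.

Lemma Ext_finite_resolution_eq0 C N (R : resolution N) m :
  (forall k, (k <= m)%N -> forall l (e : Ext abA epA l.+1 C (R k)), e = 0) ->
  (forall k, (m < k)%N -> is_zero_object (R k)) ->
  forall i (e : Ext abA epA i.+1 C N), e = 0.
Proof.
move=> orthR zeroR i; apply/Ext_trivialP => f fd0.
have [f' ff'] := proj_resolutionP f (@raug_epi _ _ R).
(* In degree 0 the boundary is the augmentation; the terms of [R] vanish from [m.+1] on. *)
have [|||g] := @resolution_cocycle_factor C N R m.+1 0 i f' => //=.
  by rewrite ff'.
by rewrite ff' => ->; exists (raug R \oc g).
Qed.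

(** A lift [g] of [f \oc raug P] along [e] need not descend to [C]; the obstruction is a 1-cocycle
    [h] with values in the kernel of [e]. Writing [h] as a coboundary of [v] corrects [g] to
    [g - k \oc v], which descends. *)
Lemma Ext1_eq0_projective C :
  (forall N (e : Ext abA epA 1 C N), e = 0) -> projective C.
Proof.
move=> ext0 M N e f eE; set P := proj_resolution abA epA C.
have [K [k kk]] := has_kernels abA e; have km := kernel_mono kk.
have [g eg] := proj_resolutionP (f \oc raug P) eE.
have augd0 : raug P \oc rdiff P 0 = 0 by apply: exact_comp0 (@rexact0 _ _ P).
have [|h [kh _]] := kk.2 _ (g \oc rdiff P 0).
  by rewrite compA eg -compA augd0 compm0.
have hd0 : h \oc rdiff P 1 = 0.
  apply: (mono_comp0 km).
  by rewrite compA kh -compA (exact_comp0 (rexactS P 0)) compm0.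
have /Ext_trivialP/(_ h hd0)[v hv] := ext0 K.
have [|w wg] := exact_epi_factor (y := g - k \oc v) (@rexact0 _ _ P) (@raug_epi _ _ P).
  by rewrite compBl -kh hv compA subrr.
exists w; apply: (@raug_epi _ _ P).
by rewrite -compA wg compBr compA kk.1 comp0m subr0.
Qed.

Lemma finite_resolutions_projectives (X : set A) :
  self_orthogonal abA epA X -> closed_under_summands X ->
  (forall M, exists m, has_resolution_of_length X M m) -> X = projectives A.
Proof.
move=> orthX sumX resX; apply/seteqP; split=> [C XC | P projP].
  apply: Ext1_eq0_projective => N; have [m [R [XR zeroR]]] := resX N.
  apply: (Ext_finite_resolution_eq0 (R := R) (m := m)) => // k km l.
  exact: orthX XC (XR k km) l.+1 _.
have [m [R [XR _]]] := resX P.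
have [s es1] := projP _ _ _ (idm P) (@raug_epi _ _ R).
have [K [k [q biprod]]] := split_epi_biproduct es1.
exact: sumX biprod (XR 0 _).
Qed.

End Abelian.

Theorem proposition4p1 (A : preadditive_category) (abA : is_abelian A)
    (epA : enough_projectives A) (X : set A)
    (subX : is_subcategory X) (preX : precovering X)
    (orthX : self_orthogonal abA epA X)
    (extX : closed_under_extensions X) (sumX : closed_under_summands X)
    (n : nat) (n_gt0 : (0 < n)%N) :
  relative_gl_dim X = Some n <->
  gl_dim A = Some n /\ X = projectives A.
Proof.
(* [gl_dim A] unfolds to [relative_gl_dim (projectives A)], so the converse holds by conversion. *)
split=> [dimX | [dimA ->]]; last exact: dimA.
have XP : X = projectives A.
  apply: (finite_resolutions_projectives orthX sumX) => M.
  by have [m /einf_Some] := esup_Some M dimX; exists m.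
by split=> //; rewrite -dimX XP.
Qed.
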